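(* Let $(X,\mathcal{A})$ be a measurable space. A subset $M$ of $M(X)$ is a maximal ideal of $M(X)$ if and only if there exists a unique $J\in\Sigma Id(\mathcal{A})$ such that $M=M^{J}$.
   Context: A measurable space $(X,\mathcal{A})$ is a nonempty set $X$ with a $\sigma$-algebra $\mathcal{A}$ of subsets of $X$. $M(X)$ is the commutative ring (pointwise operations) of all functions $f:X\to\mathbb{R}$ with $f^{-1}(V)\in\mathcal{A}$ for every open $V\subseteq\mathbb{R}$. For $f\in M(X)$, $\mathrm{coz}(f)=\{x\in X: f(x)\neq 0\}$. $\mathcal{A}$ is regarded as a lattice (a Boolean algebra) under inclusion. An ideal of $\mathcal{A}$ is a nonempty subset of $\mathcal{A}$ closed under finite unions and under passing to smaller members of $\mathcal{A}$. $Id(\mathcal{A})$ is the lattice of all ideals of $\mathcal{A}$, ordered by inclusion. For a bounded distributive lattice $L$ with top $\top$, $\Sigma L$ is the set of prime elements of $L$, i.e. elements $p<\top$ such that $a\wedge b\le p$ implies $a\le p$ or $b\le p$; thus $\Sigma Id(\mathcal{A})$ is the set of prime ideals of $\mathcal{A}$. For $I\in Id(\mathcal{A})$, $M^{I}=\{f\in M(X):\mathrm{coz}(f)\in I\}$. *)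

(* Defs.v *)
From HB Require Import structures.
From mathcomp Require Import all_boot all_order all_algebra ring_quotient.
From mathcomp Require Import all_classical all_reals all_analysis measurable_realfun.

Set Implicit Arguments.
Unset Strict Implicit.
Unset Printing Implicit Defensive.

Import Order.TTheory GRing.Theory Num.Theory.
Import numFieldNormedType.Exports.

Local Open Scope classical_set_scope.
Local Open Scope ring_scope.

(* [idealr_closed] only covers proper ideals ([1 \notin S]), so that maximality
   among them is maximality in the usual sense. *)
Definition is_maximal_ideal (A : comNzRingType) (M : set A) : Prop :=
  idealr_closed (mem M) /\
  forall N : set A, idealr_closed (mem N) -> M `<=` N -> N = M.

Section Spectrum.
Local Open Scope order_scope.

Definition prime_spectrum d (L : tbDistrLatticeType d) : set L :=
  [set p : L | (p < \top) /\
    forall a b : L, Order.meet a b <= p -> (a <= p) \/ (b <= p)].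

End Spectrum.

Definition is_set_ideal d (T : measurableType d) (I : set (set T)) : Prop :=
  [/\ I `<=` measurable,
      I !=set0,
      setU_closed I &
      forall A B, measurable A -> A `<=` B -> I B -> I A].

Record set_ideal d (T : measurableType d) := SetIdeal {
  set_ideal_val :> set (set T) ;
  set_ideal_asbool : `[< is_set_ideal set_ideal_val >]
}.

Section IdealLattice.
Context d (T : measurableType d).
Implicit Types I J K : set_ideal T.

HB.instance Definition _ := [isSub for @set_ideal_val d T].
HB.instance Definition _ := [Choice of set_ideal T by <:].

(* The order of [set (set T)] is inclusion. *)
HB.instance Definition _ := 
  [SubChoice_isSubPOrder of set_ideal T by <: with set_display].

Lemma set_idealP I : is_set_ideal I.
Proof. by apply/asboolP; exact: set_ideal_asbool. Qed.

Lemma le_set_idealE I J : (I <= J)%O = `[< (I : set (set T)) `<=` J >].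
Proof. by rewrite -Order.le_val; apply/idP/asboolP => /subsetPset. Qed.

Lemma set_ideal_set0 I : set_ideal_val I set0.
Proof.
have [_ [A IA] _ down] := set_idealP I.
by apply: down IA => //; exact: sub0set.
Qed.

Lemma is_set_ideal_meet I J :
  is_set_ideal ((I : set (set T)) `&` (J : set (set T))).
Proof.
have [Im _ IU Id] := set_idealP I; have [Jm _ JU Jd] := set_idealP J.
split.
- by move=> A [/Im].
- by exists set0; split; exact: set_ideal_set0.
- by move=> A B [IA JA] [IB JB]; split; [exact: IU|exact: JU].
- by move=> A B mA AB [IB JB]; split; [exact: Id IB|exact: Jd JB].
Qed.

Lemma is_set_ideal_join I J :
  is_set_ideal [set A `|` B | A in (I : set (set T)) & B in (J : set (set T))].
Proof.
have [Im _ IU Id] := set_idealP I; have [Jm _ JU Jd] := set_idealP J.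
split.
- by move=> _ [A /Im mA [B /Jm mB <-]]; exact: measurableU.
- by exists (set0 `|` set0), set0; [|exists set0]; try exact: set_ideal_set0.
- move=> _ _ [A IA [B JB <-]] [A' IA' [B' JB' <-]]; rewrite setUACA.
  by exists (A `|` A'); [exact: IU|exists (B `|` B') => //; exact: JU].
- move=> C D mC CD [A IA [B JB ABE]]; have CAB : C `<=` A `|` B by rewrite ABE.
  exists (C `&` A).
    by apply: (Id _ _ _ _ IA); [apply: measurableI; [|exact: Im]|exact: subIsetr].
  exists (C `&` B); last by rewrite -setIUr; apply/setIidPl.
  by apply: (Jd _ _ _ _ JB); [apply: measurableI; [|exact: Jm]|exact: subIsetr].
Qed.

Lemma is_set_ideal_bot : is_set_ideal [set (set0 : set T)].
Proof.
split.
- by move=> _ ->.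
- by exists set0.
- by move=> _ _ -> ->; rewrite setU0.
- by move=> A B _ + B0; rewrite B0 subset0.
Qed.

Lemma is_set_ideal_top : is_set_ideal (@measurable d T).
Proof. by split=> //; [exists set0|move=> A B; exact: measurableU]. Qed.

Definition set_ideal_meet I J := SetIdeal (asboolT (is_set_ideal_meet I J)).
Definition set_ideal_join I J := SetIdeal (asboolT (is_set_ideal_join I J)).
Definition set_ideal_bot := SetIdeal (asboolT is_set_ideal_bot).
Definition set_ideal_top := SetIdeal (asboolT is_set_ideal_top).

Fact set_ideal_lexI I J K :
  (I <= set_ideal_meet J K)%O = (I <= J)%O && (I <= K)%O.
Proof.
rewrite !le_set_idealE; apply/asboolP/andP => [H|[/asboolP IJ /asboolP IK]].
  by split; apply/asboolP => A /H [].
by move=> A IA; split; [exact: IJ|exact: IK].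
Qed.

Fact set_ideal_leUx I J K :
  (set_ideal_join I J <= K)%O = (I <= K)%O && (J <= K)%O.
Proof.
rewrite !le_set_idealE; apply/asboolP/andP => [H|[/asboolP IK /asboolP JK]].
  split; apply/asboolP => A IA; apply: H.
    by exists A => //; exists set0; [exact: set_ideal_set0|rewrite setU0].
  by exists set0; [exact: set_ideal_set0|exists A => //; rewrite set0U].
have [_ _ KU _] := set_idealP K.
by move=> _ [A /IK KA [B /JK KB <-]]; exact: KU.
Qed.

HB.instance Definition _ :=
  Order.POrder_MeetJoin_isLattice.Build _ (set_ideal T)
    set_ideal_lexI set_ideal_leUx.

Fact set_ideal_meetUl :
  @left_distributive (set_ideal T) (set_ideal T) Order.meet Order.join.
Proof.
move=> I J K; apply/val_inj/seteqP; split => C /=.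
  move=> [[A IA [B JB E]] KC]; have [_ _ _ Kd] := set_idealP K.
  have [Im _ _ _] := set_idealP I; have [Jm _ _ _] := set_idealP J.
  exists A; first by split=> //; apply: Kd KC; [exact: Im|rewrite -E; left].
  exists B => //; split=> //; apply: Kd KC; first exact: Jm.
  by rewrite -E; right.
move=> [A [IA KA] [B [JB KB] <-]]; split; first by exists A => //; exists B.
by have [_ _ KU _] := set_idealP K; exact: KU.
Qed.

HB.instance Definition _ :=
  Order.Lattice_Meet_isDistrLattice.Build _ (set_ideal T) set_ideal_meetUl.

Fact set_ideal_le0x I : (set_ideal_bot <= I)%O.
Proof.
by rewrite le_set_idealE; apply/asboolP => _ ->; exact: set_ideal_set0.
Qed.

Fact set_ideal_lex1 I : (I <= set_ideal_top)%O.
Proof.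
by rewrite le_set_idealE; apply/asboolP; have [] := set_idealP I.
Qed.

HB.instance Definition _ :=
  Order.hasBottom.Build _ (set_ideal T) set_ideal_le0x.
HB.instance Definition _ :=
  Order.hasTop.Build _ (set_ideal T) set_ideal_lex1.

End IdealLattice.

Definition coz (X : Type) (R : realType) (f : X -> R) : set X :=
  [set x | f x != 0].

Section FunctionIdeal.
Context d (X : measurableType d) (R : realType).

(* Measurability with respect to the Borel sets, which is what [mfun] asks for,
   can be tested on open sets. *)
Lemma measurable_fun_openP (f : X -> R) :
  measurable_fun setT f <-> forall V : set R, open V -> measurable (f @^-1` V).
Proof.
split=> [mf V oV|mf].
  by rewrite -[_ @^-1` _]setTI; apply: mf => //; exact: open_measurable.
apply: (measurability _ (RGenOpens.measurableE R)).
move=> _ [_ [a [b ->]] <-]; rewrite setTI.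
by apply: mf; exact: interval_open.
Qed.

Definition fun_ideal (I : set_ideal X) : set {mfun X >-> R} :=
  [set f : {mfun X >-> R} | set_ideal_val I (coz f)].

End FunctionIdeal.

(* Main.v *)
From HB Require Import structures.
Require Import Defs.
From mathcomp Require Import all_boot all_order all_algebra.
From mathcomp Require Import all_classical all_reals all_analysis measurable_realfun.
From mathcomp Require Import ring_quotient.

(** The correspondence rests on one property of [{mfun X >-> R}]: the pointwise
    inverse of a measurable function, with [0^-1 = 0], is measurable, so that
    [f] is a multiple of [g] as soon as [coz f `<=` coz g].  Membership of [f]
    in a ring ideal [I] thus depends only on [coz f], and the cozero sets of
    members of [I] form a set ideal [coz_ideal] with
    [I = fun_ideal (coz_ideal I)] ([fun_ideal_coz_ideal]).  Every measurable
    set is a cozero set, so [fun_ideal] is injective ([fun_ideal_inj]), whence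
    uniqueness.

    It remains to match maximality with primeness.  A maximal ideal is prime,
    and the product of the indicators of [A] and [B] has cozero set [A `&` B],
    so the corresponding set ideal is prime ([prime_coz_ideal]).  Conversely,
    if [J] is prime and [f] is not in [fun_ideal J], then [~` coz f] lies in
    [J], since it meets [coz f] in the empty set; so [f] and the indicator of
    [~` coz f] generate the unit ideal, and [fun_ideal J] is maximal
    ([maximal_fun_ideal]). *)

Set Implicit Arguments.
Unset Strict Implicit.
Unset Printing Implicit Defensive.

Import Order.TTheory GRing.Theory Num.Theory.
Import numFieldNormedType.Exports.

Local Open Scope classical_set_scope.
Local Open Scope ring_scope.

Section RingIdeals.
Context (A : comNzRingType).
Implicit Types (I M : set A).

Lemma ideal_closedP I : idealr_closed (mem I) <->
  [/\ I 0, ~ I 1 & forall a u v, I u -> I v -> I (a * u + v)].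
Proof.
split=> [[I0 I1 IS]|[I0 I1 IS]].
  split; first by have := I0; rewrite /= inE.
    by move=> H; move: I1; rewrite /= notin_setE.
  by move=> a u v Iu Iv; have := IS a u v; rewrite /= !inE; exact.
split; rewrite /= ?inE ?notin_setE //.
by move=> a u v; rewrite !inE; exact: IS.
Qed.

Lemma ideal_mull I a u : idealr_closed (mem I) -> I u -> I (a * u).
Proof.
by move=> /ideal_closedP[I0 _ IS] Iu; rewrite -[_ * _]addr0; exact: IS.
Qed.

(** Otherwise the colon ideal of the [w] with [w * u] in [M] would be a larger
    proper ideal. *)
Lemma maximal_ideal_prime M u v :
  is_maximal_ideal M -> M (v * u) -> M u \/ M v.
Proof.
move=> [Mid Mmax] Mvu; have [Mu|nMu] := pselect (M u); [by left|right].
have [M0 _ MS] := (ideal_closedP M).1 Mid.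
rewrite -(Mmax [set w | M (w * u)]) //; last first.
  by move=> w Mw /=; rewrite mulrC; exact: ideal_mull.
apply/ideal_closedP; split=> /=; rewrite ?mul0r ?mul1r //.
by move=> a w w' ? ?; rewrite mulrDl -mulrA; exact: MS.
Qed.

End RingIdeals.

Section SetIdeals.
Context d (X : measurableType d).
Implicit Types (J : set_ideal X) (A B : set X).

Lemma is_set_ideal_principal A :
  is_set_ideal [set B | measurable B /\ B `<=` A].
Proof.
split.
- by move=> B [].
- by exists set0; split.
- move=> B C [mB BA] [mC CA]; split; first exact: measurableU.
  by rewrite subUset.
- by move=> B C mB BC [_ CA]; split=> //; exact: subset_trans CA.
Qed.

Definition principal_set_ideal A := SetIdeal (asboolT (is_set_ideal_principal A)).

Lemma principal_set_ideal_le A J : measurable A ->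
  (principal_set_ideal A <= J)%O <-> set_ideal_val J A.
Proof.
move=> mA; rewrite le_set_idealE; split=> [/asboolP|JA]; first by apply; split.
apply/asboolP => B [mB BA].
by have [_ _ _ Jd] := set_idealP J; exact: Jd JA.
Qed.

(** Primeness quantifies over the lattice of ideals; testing it on principal
    ideals suffices, because every ideal is a join of principal ones. *)
Lemma prime_set_idealP J : prime_spectrum J <->
  ~ set_ideal_val J setT /\
  forall A B, measurable A -> measurable B ->
    set_ideal_val J (A `&` B) -> set_ideal_val J A \/ set_ideal_val J B.
Proof.
have [Jm _ _ Jd] := set_idealP J.
split=> [[Jlt Jp]|[JT Jp]].
  split=> [JT|A B mA mB JAB].
    move: Jlt; rewrite lt_neqAle lex1 andbT => /eqP; apply.
    apply/val_inj/seteqP; split=> //= A mA.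
    exact: Jd JT.
  rewrite -!principal_set_ideal_le //; apply: Jp.
  rewrite le_set_idealE; apply/asboolP => C [[mC CA] [_ CB]].
  by apply: Jd JAB => //; rewrite subsetI.
split=> [|I K IKJ].
  rewrite lt_neqAle lex1 andbT; apply/eqP => JE; apply: JT.
  by rewrite JE; exact: measurableT.
have [/asboolP IJ|/asboolP nIJ] := boolP `[< set_ideal_val I `<=` J >].
  by left; rewrite le_set_idealE; apply/asboolP.
right; rewrite le_set_idealE; apply/asboolP => B KB.
have [A [IA nJA]] : exists A, set_ideal_val I A /\ ~ set_ideal_val J A.
  by apply: contra_notP nIJ => + A IA => /forallNP/(_ A)/not_andP[|/contrapT].
have [Im _ _ Id] := set_idealP I; have [Km _ _ Kd] := set_idealP K.
have mA := Im _ IA; have mB := Km _ KB.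
case: (Jp A B) => //; move: IKJ; rewrite le_set_idealE => /asboolP; apply.
have mAB := measurableI _ _ mA mB.
by split; [exact: Id IA|exact: Kd KB].
Qed.

End SetIdeals.

Section CozeroSets.
Context (R : realType) d (X : measurableType d).
Implicit Types (f g : {mfun X >-> R}) (I : set {mfun X >-> R}) (J : set_ideal X).

Lemma measurable_inv : measurable_fun [set: R] (@GRing.inv R).
Proof.
have -> : [set: R] = [set 0] `|` [set~ 0] by rewrite setUv.
have o0 : open [set~ (0 : R)] by rewrite openC; exact: closed_eq.
apply/measurable_funU => //; first exact: open_measurable.
split; first exact: measurable_fun_set1.
apply: open_continuous_measurable_fun => // x /[!inE] /eqP x0.
exact: inv_continuous.
Qed.

Definition inv_mfun f : X -> R := @GRing.inv R \o f.

HB.instance Definition _ f := isMeasurableFun.Build _ _ X R (inv_mfun f)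
  (measurableT_comp measurable_inv (measurable_funPT f)).

Lemma measurable_coz f : measurable (coz f).
Proof.
apply: ((measurable_fun_openP f).1 (measurable_funPT f) [set r | r != 0]).
exact: open_neq.
Qed.

Lemma coz1 : coz (1 : {mfun X >-> R}) = setT.
Proof. by apply/seteqP; split=> // x _; rewrite /coz /= oner_neq0. Qed.

Lemma coz_mul f g : coz (f * g) = coz f `&` coz g.
Proof.
by apply/seteqP; split=> x; rewrite /coz /= mulf_eq0 negb_or => /andP.
Qed.

(** The sum of squares prevents the cancellations that can occur in [f + g]. *)
Lemma coz_sum_squares f g : coz (f * f + g * g) = coz f `|` coz g.
Proof.
apply/seteqP; split=> x; rewrite /coz /= -!expr2 paddr_eq0 ?sqr_ge0 //;
  by rewrite !sqrf_eq0 negb_and => /orP.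
Qed.

Lemma coz_indic (A : set X) (mA : measurable A) :
  coz (indic_mfun A mA : {mfun X >-> R}) = A.
Proof.
apply/seteqP; split=> x; rewrite /coz /= /mindic indicE pnatr_eq0 eqb0 negbK.
  by rewrite inE.
by move=> Ax; rewrite inE.
Qed.

(** With [0^-1 = 0], the function [g^-1 * g] is the indicator of [coz g], hence
    [f = f * g^-1 * g]. *)
Lemma ideal_coz_subset I f g :
  idealr_closed (mem I) -> coz f `<=` coz g -> I g -> I f.
Proof.
move=> Iid fg Ig; have -> : f = f * (inv_mfun g : {mfun X >-> R}) * g.
  apply/val_inj/funext => x.
  change (f x = f x * (g x)^-1 * g x); have [fx0|fx0] := eqVneq (f x) 0.
    by rewrite fx0 !mul0r.
  by rewrite mulfVK //; exact: fg.
exact: ideal_mull.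
Qed.

Lemma fun_ideal_closed J :
  ~ set_ideal_val J setT -> idealr_closed (mem (fun_ideal J : set {mfun X >-> R})).
Proof.
have [_ _ JU Jd] := set_idealP J.
move=> JT; apply/ideal_closedP; split; first 1 last.
- by rewrite /fun_ideal /= coz1.
- move=> a f g Jf Jg; apply: Jd (JU _ _ Jf Jg); first exact: measurable_coz.
  move=> x afg; apply/orP; move: afg; apply: contra_neqT.
  change (~~ ((f x != 0) || (g x != 0)) -> a x * f x + g x = 0).
  by rewrite negb_or !negbK => /andP[/eqP -> /eqP ->]; rewrite mulr0 addr0.
- by apply: Jd (set_ideal_set0 J); [exact: measurable_coz|move=> x /eqP].
Qed.

(** A set ideal is recovered from its function ideal by testing indicators. *)
Lemma fun_ideal_inj : injective (@fun_ideal d X R).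
Proof.
have sub J K : @fun_ideal d X R J = fun_ideal K -> J `<=` K.
  move=> JK A JA; have [Jm _ _ _] := set_idealP J; have mA := Jm _ JA.
  have : fun_ideal J (indic_mfun A mA : {mfun X >-> R}).
    by rewrite /fun_ideal /= coz_indic.
  by rewrite JK /fun_ideal /= coz_indic.
by move=> J K JK; apply/val_inj/seteqP; split; exact: sub.
Qed.

Lemma is_set_ideal_coz I : idealr_closed (mem I) ->
  is_set_ideal [set coz f | f in I].
Proof.
move=> Iid; have [I0 _ IS] := (ideal_closedP I).1 Iid.
split.
- by move=> _ [f _ <-]; exact: measurable_coz.
- by exists (coz (0 : {mfun X >-> R})), 0.
- move=> _ _ [f If <-] [g Ig <-]; exists (f * f + g * g).
    by apply: IS => //; exact: ideal_mull.
  exact: coz_sum_squares.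
- move=> A B mA AB [f If fB]; exists (indic_mfun A mA * f).
    exact: ideal_mull.
  by rewrite coz_mul coz_indic fB; exact/setIidPl.
Qed.

Definition coz_ideal I (Iid : idealr_closed (mem I)) :=
  SetIdeal (asboolT (is_set_ideal_coz Iid)).

Lemma fun_ideal_coz_ideal I (Iid : idealr_closed (mem I)) :
  fun_ideal (coz_ideal Iid) = I.
Proof.
apply/seteqP; split=> [f [g Ig gf]|f If]; last by exists f.
by apply: ideal_coz_subset Ig => //; rewrite gf.
Qed.

(** The product of the indicators of [A] and [B] has cozero set [A `&` B], so
    primeness of [I] as a ring ideal passes to its cozero sets. *)
Lemma prime_coz_ideal I (Imax : is_maximal_ideal I) :
  prime_spectrum (coz_ideal Imax.1).
Proof.
have Iid := Imax.1; have [_ I1 _] := (ideal_closedP I).1 Iid.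
apply/prime_set_idealP; split=> [[f If fT]|A B mA mB [f If fAB]].
  by apply: I1; apply: ideal_coz_subset If => //; rewrite fT.
have : I (indic_mfun A mA * indic_mfun B mB).
  by apply: ideal_coz_subset If => //; rewrite fAB coz_mul !coz_indic.
case/(maximal_ideal_prime Imax) => IAB; [right|left].
  by exists (indic_mfun B mB) => //; exact: coz_indic.
by exists (indic_mfun A mA) => //; exact: coz_indic.
Qed.

(** Primeness, applied to [coz f] and its complement, puts the complement in [J]
    as soon as [f] is not in [fun_ideal J]. *)
Lemma maximal_fun_ideal J : prime_spectrum J ->
  is_maximal_ideal (fun_ideal J : set {mfun X >-> R}).
Proof.
move=> /prime_set_idealP[JT Jp]; split=> [|N Nid JN]; first exact: fun_ideal_closed.
have [_ N1 NS] := (ideal_closedP N).1 Nid.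
apply/seteqP; split=> // f Nf.
have mf := measurable_coz f; have mfC := measurableC mf.
case: (Jp _ _ mf mfC) => // [|JfC]; first by rewrite setICr; exact: set_ideal_set0.
(* [f * f + e * e] vanishes nowhere, so the ideal [N] would contain [1]. *)
pose e : {mfun X >-> R} := indic_mfun (~` coz f) mfC.
have Ne : N e by apply: JN; rewrite /fun_ideal /= coz_indic.
case: N1; apply: (@ideal_coz_subset _ _ (f * f + e * e)) => //.
  by rewrite coz_sum_squares coz_indic setUv.
by apply: NS => //; exact: ideal_mull.
Qed.

End CozeroSets.

Theorem proposition11 (R : realType) (d : measure_display)
    (X : measurableType d) (M : set {mfun X >-> R}) :
  is_maximal_ideal M <->
  exists! J : set_ideal X, prime_spectrum J /\ M = fun_ideal J.
Proof.
split=> [Mmax|[J [[Jprime ->] _]]]; last exact: maximal_fun_ideal.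
exists (coz_ideal Mmax.1); split.
  by rewrite fun_ideal_coz_ideal; split=> //; exact: prime_coz_ideal.
move=> J [_ MJ]; apply: (@fun_ideal_inj R).
by rewrite fun_ideal_coz_ideal.
Qed.
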